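(* Each of $\mathrm{MaxIS}_{\geq}$, $\mathrm{MaxClique}_{\geq}$ and $\mathrm{MinVC}_{\leq}$ admits a streaming certification scheme with certificates of $O(\min\{k\log n, n\})$ bits and verifier's space complexity $O(\log n)$ bits, for all $n$-node graphs and thresholds $k\geq 1$.
   Context: $\mathrm{MaxIS}_{\geq}$ (resp. $\mathrm{MaxClique}_{\geq}$) takes as input a graph $G$ and threshold $k$ and asks whether $G$ has a maximum independent set (resp. maximum clique) of size at least $k$; $\mathrm{MinVC}_{\leq}$ asks whether $G$ has a minimum vertex cover of size at most $k$. Inputs: an $n$-node graph on $[n]$ and threshold $k$; $k$ is given first, then the edges arrive as a stream in an arbitrary, possibly adversarial, order. A streaming certification scheme for a decision problem $P$ consists of a prover (a computationally unlimited function producing a certificate $c\in\{0,1\}^*$ depending only on the input, not on the edge order) and a verifier (a deterministic streaming algorithm with read-only access to $c$ that processes the stream and outputs accept or reject). Completeness: if the input satisfies $P$, some certificate makes the verifier accept for every edge order. Soundness: if the input does not satisfy $P$, the verifier rejects for every certificate and every edge order. The verifier's space complexity excludes the read-only certificate. *)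

(* Defs.v *)
From mathcomp Require Import all_boot.

Set Implicit Arguments.
Unset Strict Implicit.
Unset Printing Implicit Defensive.

(* Simple graphs on the vertex set [n], here {0, ..., n-1}. *)
Record sgraph (n : nat) := SGraph {
  edge : rel 'I_n;
  edge_sym : symmetric edge;
  edge_irr : irreflexive edge }.

Section Problems.

Variable n : nat.
Implicit Types (G : sgraph n) (P : pred {set 'I_n}) (S : {set 'I_n}).

Definition independent G : pred {set 'I_n} :=
  fun S => [forall u in S, forall v in S, ~~ edge G u v].

Definition clique G : pred {set 'I_n} :=
  fun S => [forall u in S, forall v in S, (u != v) ==> edge G u v].

Definition vertex_cover G : pred {set 'I_n} :=
  fun S => [forall u, forall v, edge G u v ==> (u \in S) || (v \in S)].

(* Maximum and minimum are meant with respect to cardinality, unlike [maxset]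
   and [minset], which are with respect to inclusion. *)
Definition maximum P S : Prop := P S /\ forall S', P S' -> #|S'| <= #|S|.

Definition minimum P S : Prop := P S /\ forall S', P S' -> #|S| <= #|S'|.

Definition edge_set G : {set {set 'I_n}} :=
  [set [set p.1; p.2] | p in [pred p : 'I_n * 'I_n | edge G p.1 p.2]].

(* Every edge occurs exactly once, at an arbitrary position of the stream and
   with its two endpoints given in an arbitrary order. *)
Definition edge_stream G (s : seq ('I_n * 'I_n)) : bool :=
  perm_eq [seq [set p.1; p.2] | p <- s] (enum (edge_set G)).

End Problems.

Definition decision_problem := forall n : nat, sgraph n -> nat -> Prop.

Definition MaxIS_ge : decision_problem := fun n G k =>
  exists S : {set 'I_n}, maximum (independent G) S /\ k <= #|S|.

Definition MaxClique_ge : decision_problem := fun n G k =>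
  exists S : {set 'I_n}, maximum (clique G) S /\ k <= #|S|.

Definition MinVC_le : decision_problem := fun n G k =>
  exists S : {set 'I_n}, minimum (vertex_cover G) S /\ #|S| <= k.

(* What the verifier does next, as a function of its memory alone. The next
   edge of the stream, or the certificate bit at a given address, is delivered
   once, and whatever is to be remembered of it must be kept in the new memory.
   [None] signals the end of the stream, resp. an address past the end of the
   certificate. *)
Inductive action :=
  | NextEdge of (option (nat * nat) -> bitseq)
  | ReadCert of nat & (option bool -> bitseq)
  | Output of bool.

(* A single verifier handles all n and k: the memory is a string of bits, it
   initially depends only on n and k, and anything needed later on, n and k
   included, has to be stored in it. *)
Record verifier := Verifier {
  start : nat -> nat -> bitseq;
  act : bitseq -> action }.

Section Run.

Variables (V : verifier) (c : bitseq).

(* A configuration consists of the memory and the rest of the stream. *)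
Definition next_config (x : bitseq * seq (nat * nat)) :=
  match act V x.1 with
  | NextEdge f => (f (ohead x.2), behead x.2)
  | ReadCert i f => (f (onth c i), x.2)
  | Output _ => x
  end.

Variables (n k : nat) (s : seq ('I_n * 'I_n)).

Definition memory_at (t : nat) : bitseq :=
  (iter t next_config
     (start V n k, [seq (val p.1, val p.2) | p <- s])).1.

Definition outputs (b : bool) : Prop :=
  exists t : nat, act V (memory_at t) = Output b.

Definition space_at_most (m : nat) : Prop :=
  forall t : nat, size (memory_at t) <= m.

End Run.

(* The certificate does not depend on the order of the edges. *)
Definition prover := forall n : nat, sgraph n -> nat -> bitseq.

(* The verifier must reach a verdict also on the runs that neither completeness
   nor soundness constrains: a wrong certificate for a positive instance. *)
Definition certifies (P : decision_problem) (A : prover) (V : verifier) : Prop :=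
  forall (n : nat) (G : sgraph n) (k : nat), 0 < k ->
  [/\ forall c s, edge_stream G s -> exists b, outputs V c k s b,
      P n G k -> forall s, edge_stream G s -> outputs V (A n G k) k s true
    & ~ P n G k -> forall c s, edge_stream G s -> outputs V c k s false].

(* P has a scheme with certificates of O(f n k) bits and a verifier using
   O(g n) bits of space. The bounds start at n = 2, since f and g are meant to
   involve log n, which vanishes at n = 1; the space bound holds for every
   certificate, however long. *)
Definition admits_scheme (P : decision_problem)
    (f : nat -> nat -> nat) (g : nat -> nat) : Prop :=
  exists (A : prover) (V : verifier),
    certifies P A V /\
    exists C : nat, forall (n : nat) (G : sgraph n) (k : nat), 1 < n -> 0 < k ->
      size (A n G k) <= C * f n k /\
      forall c s, edge_stream G s -> space_at_most V c k s (C * g n).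

(* Main.v *)
Require Import Defs.
From mathcomp Require Import all_boot.
From mathcomp Require Import zify.

(** For [k <= n] each of the three problems asks for a set [S] of exactly [k]
    vertices for which the number of edges inside [S] (inside the complement of
    [S] for vertex covers) takes a prescribed value: 0 for independent sets and
    vertex covers, ['C(k, 2)] for cliques. Since every edge occurs once in the
    stream, this number can be counted with O(log n) bits. The certificate is
    the increasing list of the elements of [S], or the characteristic vector of
    [S] if that is shorter, and it is rescanned for every edge. Each scan drops
    the values that are not vertices above all the previous ones, so that any
    certificate whatsoever denotes a set, whose size is the number of values
    kept. *)

Set Implicit Arguments.
Unset Strict Implicit.
Unset Printing Implicit Defensive.

(** * Registers in binary *)

Definition width (r : seq nat) : nat := (trunc_log 2 (\max_(x <- r) x)).+1.

(* The registers are interleaved bit by bit, so that they can be unpacked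
   without knowing the width. *)
Definition pack (r : seq nat) : bitseq :=
  mkseq (fun a => odd (nth 0 r (a %% size r) %/ 2 ^ (a %/ size r)))
        (width r * size r).

(** The range [size m] overshoots the bits of one register; the positions beyond them fall outside
    [m] and contribute 0. *)
Definition unpack (q : nat) (m : bitseq) (j : nat) : nat :=
  \sum_(i < size m) nth false m (i * q + j) * 2 ^ i.

Lemma sum_bits N x : x < 2 ^ N -> \sum_(i < N) odd (x %/ 2 ^ i) * 2 ^ i = x.
Proof.
elim: N x => [|N IHN] x ltx; first by rewrite big_ord0; case: x ltx.
rewrite big_ord_recl expn0 divn1 muln1 -[RHS]odd_double_half -divn2.
rewrite -{1}(IHN (x %/ 2)); last by rewrite ltn_divLR // mulnC -expnS.
rewrite -muln2 big_distrl /=; congr (_ + _); apply: eq_bigr => i _.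
by rewrite -divnMA -expnS /bump /= add1n mulnAC -mulnA -expnS.
Qed.

Lemma ltn_width r j : nth 0 r j < 2 ^ width r.
Proof.
apply: leq_ltn_trans (trunc_log_ltn _ _) => //.
have [ltj|lej] := ltnP j (size r); last by rewrite nth_default.
by apply: (leq_bigmax_seq (F := id)) => //; apply: mem_nth.
Qed.

Lemma nth_pack r i j : j < size r ->
  nth false (pack r) (i * size r + j) = odd (nth 0 r j %/ 2 ^ i).
Proof.
move=> ltj; have q0 : 0 < size r by apply: leq_trans ltj.
have [lti|lei] := ltnP i (width r).
  rewrite nth_mkseq; last first.
    apply: (@leq_trans (i.+1 * size r)); last by rewrite leq_mul2r lti orbT.
    by rewrite mulSn addnC ltn_add2r.
  by rewrite divnMDl // (divn_small ltj) addn0 modnMDl modn_small.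
rewrite nth_default; last first.
  by rewrite size_mkseq (leq_trans _ (leq_addr _ _)) // leq_mul2r lei orbT.
by rewrite divn_small // (leq_trans (ltn_width r j)) // leq_exp2l.
Qed.

Lemma packK r j : j < size r -> unpack (size r) (pack r) j = nth 0 r j.
Proof.
move=> ltj; rewrite -[RHS](@sum_bits (size (pack r))).
  by apply: eq_bigr => i _; rewrite nth_pack.
rewrite (leq_trans (ltn_width r j)) // leq_exp2l // size_mkseq.
by rewrite leq_pmulr // (leq_trans _ ltj).
Qed.

Lemma size_pack B r : all (leq^~ B) r ->
  size (pack r) <= (trunc_log 2 B).+1 * size r.
Proof.
move=> /allP leB; rewrite size_mkseq leq_mul2r ltnS leq_trunc_log ?orbT //.
by apply/bigmax_leqP_seq => i /leB.
Qed.

(** * The verifier *)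

(* [ru] and [rv] are the endpoints of the current edge, [rp] the position in the
   certificate, [rx] the binary prefix of the list entry being read, [rl] the
   least acceptable next vertex, [rc] the number of vertices accepted in this
   scan, [rh] how many of them are [ru] or [rv], and [rg] the number of previous
   edges counted. *)
Record regs := Regs {
  rn : nat; rk : nat; ru : nat; rv : nat; rp : nat;
  rx : nat; rl : nat; rc : nat; rh : nat; rg : nat }.

Definition seq_regs r :=
  [:: rn r; rk r; ru r; rv r; rp r; rx r; rl r; rc r; rh r; rg r].

Inductive state := Done of bool | Scan of regs.

Definition write (st : state) : bitseq :=
  match st with
  | Done b => [:: true; b]
  | Scan r => false :: pack (seq_regs r)
  end.

Definition read (m : bitseq) : state :=
  if m is b :: m' then
    if b then Done (head false m') else
    let d := unpack 10 m' in
    Scan (Regs (d 0) (d 1) (d 2) (d 3) (d 4) (d 5) (d 6) (d 7) (d 8) (d 9))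
  else Done false.

Lemma writeK : cancel write read.
Proof.
case=> [b|[n k u v p x l c h g]] //=.
pose r := [:: n; k; u; v; p; x; l; c; h; g].
by congr (Scan (Regs _ _ _ _ _ _ _ _ _ _)); exact: (@packK r).
Qed.

Section Format.

Variables n k : nat.

(** Depends on [n] and [k] alone, so that prover and verifier agree on the format. *)
Definition sparse : bool := k * trunc_log 2 n <= n.

Definition block : nat := (trunc_log 2 n).+1.

Definition cert_size : nat := if sparse then k * block else n.

(* The value [n], which is no vertex, stands for the absence of a value. *)
Definition value (p x : nat) (b : bool) : nat :=
  if sparse then if block %| p.+1 then x.*2 + b else n
  else if b then p else n.

(* Truncation at [n] keeps the memory small for malformed certificates. *)
Definition next_prefix (p x : nat) (b : bool) : nat :=
  if sparse && ~~ (block %| p.+1) then minn (x.*2 + b) n else 0.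

Definition lim (D : seq nat) : nat := if D is y :: _ then y.+1 else 0.

(** Reference semantics of a scan: the pending prefix and the values kept, latest first. The machine
    stores only statistics of this list. *)
Fixpoint decode (c : bitseq) (p : nat) : nat * seq nat :=
  if p is p'.+1 then
    let: (x, D) := decode c p' in
    let b := nth false c p' in
    let y := value p' x b in
    (next_prefix p' x b, if lim D <= y < n then y :: D else D)
  else (0, [::]).

Definition decoded c : seq nat := (decode c cert_size).2.

Lemma decode_prefix c p : (decode c p).1 <= n.
Proof.
case: p => [|p] //=; case: decode => x D /=; rewrite /next_prefix.
by case: ifP => // _; rewrite geq_minr.
Qed.

Lemma decode_sorted c p :
  sorted gtn (decode c p).2 && all (gtn n) (decode c p).2.
Proof.
elim: p => [|p] //=; case: decode => x D /= /andP[sD aD].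
case: ifP => [/andP[leD lty]|_]; last by rewrite sD.
by rewrite /= lty aD andbT; case: D leD sD {aD} => //= z D -> ->.
Qed.

Lemma decode_uniq c p : uniq (decode c p).2.
Proof.
case/andP: (decode_sorted c p) => sD _.
apply: (sorted_uniq (leT := gtn)) sD => [y x z /= xy yz|x /=].
  exact: ltn_trans xy.
by rewrite ltnn.
Qed.

Lemma decode_ltn c p y : y \in (decode c p).2 -> y < n.
Proof. by case/andP: (decode_sorted c p) => _ /allP; apply. Qed.

Lemma decode_lim c p : lim (decode c p).2 <= n.
Proof.
have := @decode_ltn c p; case: (decode c p).2 => //= y D; apply.
exact: mem_head.
Qed.

End Format.

Definition vertices n (D : seq nat) : {set 'I_n} := [set i : 'I_n | val i \in D].

Lemma card_vertices n D : uniq D -> all (gtn n) D -> #|vertices n D| = size D.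
Proof.
move=> uD /allP aD; rewrite cardE -(size_map val); apply/perm_size/uniq_perm => //.
  by rewrite map_inj_uniq ?enum_uniq //; exact: val_inj.
move=> x; apply/mapP/idP => [[i]|xD]; first by rewrite mem_enum inE => iD ->.
by exists (Ordinal (aD x xD)); rewrite // mem_enum inE.
Qed.

Lemma size_decode n k c p : size (decode n k c p).2 <= n.
Proof.
rewrite -(@card_vertices n); first by rewrite (leq_trans (max_card _)) ?card_ord.
  exact: decode_uniq.
by case/andP: (decode_sorted n k c p).
Qed.

(** * Honest certificates *)

(** Entries are written most significant bit first, so that a scan rebuilds them by doubling. *)
Definition encode n k (S : {set 'I_n}) : bitseq :=
  let l := [seq i <- iota 0 n | i \in map val (enum S)] in
  if sparse n k then
    mkseq (fun p => odd (nth 0 l (p %/ block n)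
                           %/ 2 ^ (block n - (p %% block n).+1)))
          (k * block n)
  else mkseq (mem l) n.

Section Encode.

Variables (n : nat) (S : {set 'I_n}).

Let l := [seq i <- iota 0 n | i \in map val (enum S)].

Let mem_l i : i \in l = (i \in map val (enum S)).
Proof.
rewrite mem_filter mem_iota add0n /=; case: mapP => //= -[j _ ->].
exact: ltn_ord.
Qed.

Let vertices_l : vertices n l = S.
Proof. by apply/setP=> i; rewrite inE mem_l (mem_map val_inj) mem_enum. Qed.

Let sorted_l : sorted ltn l.
Proof. by apply: sorted_filter (iota_ltn_sorted _ _); exact: ltn_trans. Qed.

Let uniq_l : uniq l. Proof. by rewrite filter_uniq ?iota_uniq. Qed.

Let all_l : all (gtn n) l.
Proof. by apply/allP=> i; rewrite mem_filter mem_iota => /andP[]. Qed.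

Let size_l : size l = #|S|.
Proof. by rewrite -(card_vertices uniq_l all_l) vertices_l. Qed.

(** A sparse entry takes one bit more than [trunc_log 2 n], hence at most twice as many since
    [1 < n]. *)
Lemma size_encode k : 1 < n ->
  size (encode k S) <= 2 * minn (k * trunc_log 2 n) n.
Proof.
move=> n1; have t0 : 0 < trunc_log 2 n by rewrite trunc_log_gt0.
rewrite /encode; case: ifPn; rewrite /sparse -?ltnNge => le; rewrite size_mkseq.
  rewrite (minn_idPl le) /block; nia.
rewrite (minn_idPr (ltnW le)); lia.
Qed.

Lemma decode_dense k p : ~~ sparse n k -> p <= n ->
  decode n k (encode k S) p = (0, rev [seq i <- iota 0 p | i \in l]).
Proof.
move=> ns; elim: p => // p IHp ltp; rewrite -[in iota _ _]addn1 iotaD.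
rewrite cats1 filter_rcons add0n /= IHp ?(ltnW ltp) //.
rewrite /next_prefix /value /encode (negPf ns) -/l nth_mkseq //=.
case: (boolP (p \in l)) => pl; last by rewrite ltnn andbF.
rewrite rev_rcons ltp andbT; case: ifP => // /negP[].
(* Everything kept so far is below [p], so [p] cannot be rejected. *)
set D := filter _ _; have : all (gtn p) D.
  by apply/allP=> i; rewrite mem_filter mem_iota => /andP[].
by rewrite -all_rev; case: (rev D) => //= y D' /andP[].
Qed.

(** Invariant: the complete blocks have delivered the first [p %/ block n] elements, and the prefix
    holds the leading [p %% block n] bits of the next one. *)
Lemma decode_sparse k p : sparse n k -> #|S| = k -> p <= k * block n ->
  decode n k (encode k S) p
    = (nth 0 l (p %/ block n) %/ 2 ^ (block n - p %% block n),
       rev (take (p %/ block n) l)).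
Proof.
move=> sp Sk; have ltl j : nth 0 l j < 2 ^ block n.
  have [ltj|lej] := ltnP j (size l); last by rewrite nth_default ?expn_gt0.
  apply: ltn_trans (trunc_log_ltn n (isT : 1 < 2)).
  by apply: (allP all_l); rewrite mem_nth.
elim: p => [|p IHp] ltp.
  by rewrite div0n mod0n subn0 divn_small ?ltl // take0.
rewrite /= IHp ?(ltnW ltp) //.
rewrite /next_prefix /value /encode sp -/l nth_mkseq //=.
set L := block n; set j := p %/ L; set i := p %% L.
have L0 : 0 < L by [].
have ltj : j < size l by rewrite size_l Sk ltn_divLR.
have ltiL : i < L by rewrite ltn_mod.
have step : (nth 0 l j %/ 2 ^ (L - i)).*2 + odd (nth 0 l j %/ 2 ^ (L - i.+1))
    = nth 0 l j %/ 2 ^ (L - i.+1).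
  rewrite -[L - i]/(L.+1 - i.+1) subSn // expnSr divnMA divn2 addnC.
  exact: odd_double_half.
have pE : p = j * L + i by exact: divn_eq.
have ltn_l : nth 0 l j < n by apply: (allP all_l); rewrite mem_nth.
(* If bit [p] ends its block, the entry is kept because [l] increases, and the prefix restarts at 0.
   Otherwise the prefix gains a bit, and truncation at [n] does not alter it. *)
rewrite step; case: (boolP (L %| p.+1)) => [dv|ndv] /=.
  have iE : i.+1 = L.
    apply/eqP; rewrite eqn_leq ltiL /= leqNgt; apply/negP => lt.
    by move: dv; rewrite pE -addnS dvdn_addr ?dvdn_mull // => /dvdn_leq; lia.
  have pE' : p.+1 = j.+1 * L by rewrite mulSnr -{2}iE addnS -pE.
  rewrite iE subnn expn0 divn1 ltn_l andbT pE' mulnK // modnMl subn0.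
  rewrite (divn_small (ltl _)) (take_nth 0) // rev_rcons.
  case: ifP => // /negP[].
  have : all (gtn (nth 0 l j)) (take j l).
    apply/(all_nthP 0) => a; rewrite size_take ltj => ltaj.
    rewrite nth_take //=; apply: (sorted_ltn_nth ltn_trans) => //.
    by rewrite inE (ltn_trans ltaj).
  by rewrite -all_rev; case: (rev _) => //= y D' /andP[].
have ltiL' : i.+1 < L.
  rewrite ltn_neqAle ltiL andbT; apply: contra ndv => /eqP iE.
  by rewrite (_ : p.+1 = j.+1 * L) ?dvdn_mull // mulSnr -{2}iE addnS -pE.
have pE' : p.+1 = j * L + i.+1 by rewrite pE addnS.
rewrite pE' divnMDl // modnMDl (divn_small ltiL') modn_small // addn0 ltnn
  andbF.
by rewrite (minn_idPl _) // (leq_trans (leq_div _ _)) // ltnW.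
Qed.

Lemma encodeK k : #|S| = k -> vertices n (decoded n k (encode k S)) = S.
Proof.
move=> Sk; rewrite /decoded /cert_size -[RHS]vertices_l.
case: ifPn => [sp|ns].
  rewrite decode_sparse // mulnK //= take_oversize ?size_l ?Sk //.
  by apply/setP => i; rewrite !inE mem_rev.
rewrite decode_dense //=; apply/setP => i; rewrite !inE mem_rev mem_filter.
by rewrite mem_iota /= ltn_ord andbT.
Qed.

End Encode.

(** * Correctness and space *)

Section Machine.

Variables (hits : nat) (target : nat -> nat) (default : bool).

Definition scan_step (r : regs) (b : bool) : regs :=
  let: Regs n k u v p x l c h g := r in
  let y := value n k p x b in
  let ok := l <= y < n in
  Regs n k u v p.+1 (next_prefix n k p x b) (if ok then y.+1 else l)
    (ok + c) ((ok && (y == u)) + (ok && (y == v)) + h) g.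

(** An edge is judged only when the next item is requested; the end of the stream settles the last
    one. *)
Definition edge_step (r : regs) (e : option (nat * nat)) : state :=
  let g := rg r + (rh r == hits) in
  if e is Some (u, v) then Scan (Regs (rn r) (rk r) u v 0 0 0 0 0 g)
  else Done ((rc r == rk r) && (g == target (rk r))).

(** Missing certificate bits read as [false], in agreement with [decode]. *)
Definition state_act (st : state) : action :=
  match st with
  | Done b => Output b
  | Scan r =>
      if rp r < cert_size (rn r) (rk r)
      then ReadCert (rp r) (fun b => write (Scan (scan_step r (odflt false b))))
      else NextEdge (fun e => write (edge_step r e))
  end.

(* Until the first edge is loaded, the registers hold the non-vertex [n] as both
   endpoints, and the hit counter starts at 1 so that it never equals [hits],
   which is 0 or 2. *)
Definition initial n k : state :=
  if k <= n then Scan (Regs n k n n 0 0 0 0 1 0) else Done default.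

Definition machine : verifier :=
  Verifier (fun n k => write (initial n k)) (fun m => state_act (read m)).

Section Run.

Variables (n k : nat) (c : bitseq).

(* The registers after [p] bits of the scan for the edge [uv]. *)
Definition scan_regs (u v h g p : nat) : regs :=
  let: (x, D) := decode n k c p in
  Regs n k u v p x (lim D) (size D) (count_mem u D + count_mem v D + h) g.

Lemma scan_regsE u v h g p (r := scan_regs u v h g p) :
  (rn r = n) * (rk r = k) * (rp r = p) * (rg r = g).
Proof. by rewrite /r /scan_regs; case: decode. Qed.

Lemma scan_regsS u v h g p :
  scan_step (scan_regs u v h g p) (nth false c p) = scan_regs u v h g p.+1.
Proof.
rewrite /scan_regs /=; case: decode => x D /=.
by case: ifP => _ //=; congr Regs; lia.
Qed.

Notation reach x y := (exists t, iter t (next_config machine c) x = y).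

Lemma reach_trans x y z : reach x y -> reach y z -> reach x z.
Proof. by case=> t1 <- [t2 <-]; exists (t2 + t1); rewrite iterD. Qed.

Lemma next_scan u v h g p s : p < cert_size n k ->
  next_config machine c (write (Scan (scan_regs u v h g p)), s)
    = (write (Scan (scan_regs u v h g p.+1)), s).
Proof.
move=> ltp; rewrite -scan_regsS -odflt_onth /next_config /act /machine.
by rewrite [X in state_act X]writeK /= !scan_regsE ltp.
Qed.

Lemma next_edge u v h g s :
  next_config machine c (write (Scan (scan_regs u v h g (cert_size n k))), s)
    = (write (edge_step (scan_regs u v h g (cert_size n k)) (ohead s)),
       behead s).
Proof.
rewrite /next_config /act /machine.
by rewrite [X in state_act X]writeK /= !scan_regsE ltnn.
Qed.

Lemma scan_reach u v h g s :
  reach (write (Scan (scan_regs u v h g 0)), s)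
        (write (Scan (scan_regs u v h g (cert_size n k))), s).
Proof.
have: cert_size n k <= cert_size n k by [].
elim: {1 3}(cert_size n k) => [|p IHp] ltp; first by exists 0.
apply: reach_trans (IHp (ltnW ltp)) _; exists 1.
exact: next_scan.
Qed.

Let D := decoded n k c.

Definition hit (e : nat * nat) : bool :=
  count_mem e.1 D + count_mem e.2 D == hits.

(** Induction on the unread stream; the middle summand is the pending verdict on the edge [uv]. *)
Lemma run_reach u v h g s :
  reach (write (Scan (scan_regs u v h g 0)), s)
    (write (Done ((size D == k) &&
       (g + (count_mem u D + count_mem v D + h == hits) + count hit s
          == target k))), [::]).
Proof.
elim: s u v h g => [|[u' v'] s IHs] u v h g.
  apply: reach_trans (scan_reach _ _ _ _ _) _; exists 1.
  rewrite /= next_edge /= /scan_regs /D /decoded; case: decode => x E /=.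
  by rewrite addn0.
apply: reach_trans (scan_reach _ _ _ _ _) _.
have := IHs u' v' 0
  (g + (count_mem u D + count_mem v D + h == hits)).
rewrite addn0 -(addnA (g + _)) => IH; apply: reach_trans _ IH; exists 1.
rewrite /= next_edge /=.
by rewrite /edge_step /scan_regs /D /decoded; case: decode.
Qed.

(* [g] grows by at most one whenever an edge is read, so its sum with the length
   of the remaining stream never exceeds the length [N] of the whole stream. *)
Definition reachable (N : nat) (x : bitseq * seq (nat * nat)) : Prop :=
  (exists b, x.1 = write (Done b)) \/
  exists u v h g p, [/\ x.1 = write (Scan (scan_regs u v h g p)),
    [&& u <= n, v <= n, h <= 1, p <= cert_size n k & g + size x.2 <= N]
    & all (fun e => (e.1 < n) && (e.2 < n)) x.2].

Lemma reachable_next N x :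
  reachable N x -> reachable N (next_config machine c x).
Proof.
case: x => m s /= [[b /= ->]|[u [v [h [g [p [/= -> + ss]]]]]]].
  by left; exists b; rewrite /next_config.
case/and5P=> un vn h1 ps gs; have [ltp|] := ltnP p (cert_size n k).
  rewrite next_scan //; right; exists u, v, h, g, p.+1; split => //=.
  by rewrite un vn h1 ltp.
move=> lep; have -> : p = cert_size n k by apply/eqP; rewrite eqn_leq ps.
rewrite next_edge; case: s ss gs => [|[u' v'] s] /=; first by left; eexists.
case/andP => /andP[u'n v'n] ss gs; right.
exists u', v', 0, (g + (rh (scan_regs u v h g (cert_size n k)) == hits)), 0.
split => //=.
  by rewrite /edge_step !scan_regsE [in RHS]/scan_regs.
rewrite (ltnW u'n) (ltnW v'n) /= -addnA; apply: leq_trans gs.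
by rewrite leq_add2l -[_.+1]add1n leq_add2r leq_b1.
Qed.

End Run.
End Machine.

Lemma size_write_scan n k c u v h g p : 1 < n -> k <= n -> u <= n -> v <= n ->
  h <= 1 -> p <= cert_size n k -> g <= n * n ->
  size (write (Scan (scan_regs n k c u v h g p))) <= 81 * trunc_log 2 n.
Proof.
move=> n1 kn un vn h1 pc gn.
have t0 : 0 < trunc_log 2 n by rewrite trunc_log_gt0.
(* In the sparse format [k * block n] is [k * trunc_log 2 n + k], and both terms are at most [n]. *)
have pn : p <= n + n.
  apply: leq_trans pc _; rewrite /cert_size /block; case: ifP => [|_]; last lia.
  rewrite /sparse; nia.
have logB : trunc_log 2 (n ^ 4) < 4 * (trunc_log 2 n).+1.
  rewrite -(@ltn_exp2l 2) //; apply: leq_ltn_trans (trunc_logP _ _) _ => //.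
    by rewrite expn_gt0 (ltnW n1).
  by rewrite mulnC expnM ltn_exp2r // trunc_log_ltn.
have n4 : 4 * (n * n) <= n ^ 4 
  by rewrite (expnM n 2 2) -!mulnn leq_mul2r (leq_mul n1 n1) orbT.
have n2 : n + n <= n * n by nia.
(* One tag bit plus ten registers of at most [4 * (trunc_log 2 n).+1 <= 8 * trunc_log 2 n] bits each
   gives 81. *)
have sz : forall r, all (leq^~ (n ^ 4)) (seq_regs r) ->
    size (write (Scan r)) <= 81 * trunc_log 2 n.
  by move=> r /size_pack /= le; lia.
apply: sz; rewrite /scan_regs; move: (decode_prefix n k c p) (decode_lim n k c p).
move: (size_decode n k c p); case: decode => x D /= sD xn lD.
have := count_size (pred1 u) D; have := count_size (pred1 v) D.
move: (count_mem u D) (count_mem v D) (lim D) lD => cu cv l ln cvD cuD.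
move: (n * n) (n ^ 4) n4 n2 gn => nn nnnn n4 n2 gn.
move: (leq_trans cuD sD) (leq_trans cvD sD) => {cuD cvD}cuD cvD.
by rewrite /=; repeat (apply/andP; split); lia.
Qed.

Section Scheme.

(* [cov] tells whether the edges counted are those inside the complement of the
   certified set; [default] is the answer if [k > n]. *)
Variables (cov : bool) (target : nat -> nat) (default : bool).

Definition region n (S : {set 'I_n}) : {set 'I_n} := if cov then ~: S else S.

Definition edges_in n (G : sgraph n) (R : {set 'I_n}) : {set {set 'I_n}} :=
  [set e in edge_set G | e \subset R].

Definition hits_in : nat := if cov then 0 else 2.

Let V := machine hits_in target default.

Lemma card_edges_in n (G : sgraph n) s R : edge_stream G s ->
  #|edges_in G R| = count (fun p => [set p.1; p.2] \subset R) s.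
Proof.
move=> /permP sG; rewrite -sum1_card.
under eq_bigl do rewrite inE.
by rewrite -big_enum_cond sum1_count -sG count_map.
Qed.

(** The decoded list is duplicate-free, so an edge scores its number of endpoints in the set: 2
    exactly when it lies inside, 0 exactly when it lies in the complement. *)
Lemma count_hit n k c (G : sgraph n) s : edge_stream G s ->
  count (hit hits_in n k c) [seq (val p.1, val p.2) | p <- s]
    = #|edges_in G (region (vertices n (decoded n k c)))|.
Proof.
move=> sG; rewrite (card_edges_in _ sG) count_map; apply: eq_count => -[u v] /=.
rewrite /hit !count_uniq_mem ?decode_uniq //= subUset !sub1set /region /hits_in.
by case: cov; rewrite !inE; do 2!case: (_ \in _).
Qed.

Lemma size_edge_stream n (G : sgraph n) s : edge_stream G s -> size s <= n * n.
Proof.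
move=> /perm_size; rewrite size_map -cardE => ->.
rewrite (leq_trans (leq_imset_card _ _)) // (leq_trans (max_card _)) //.
by rewrite card_prod card_ord.
Qed.

Lemma outputs_machine n k c (G : sgraph n) s : k <= n -> edge_stream G s ->
  let S := vertices n (decoded n k c) in
  outputs V c k s ((#|S| == k) && (#|edges_in G (region S)| == target k)).
Proof.
move=> kn sG S; have uD := decode_uniq n k c (cert_size n k).
have /andP[_ aD] := decode_sorted n k c (cert_size n k).
have nD : count_mem n (decoded n k c) = 0.
  by apply/count_memPn/negP => /decode_ltn; rewrite ltnn.
have [t Et] := @run_reach hits_in target default n k c n n 1 0
                 [seq (val p.1, val p.2) | p <- s].
exists t; rewrite /memory_at /= /initial kn.
have -> : Regs n k n n 0 0 0 0 1 0 = scan_regs n k c n n 1 0 0 by [].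
rewrite Et /= nD (count_hit k c sG) -/S /S card_vertices //.
by rewrite /hits_in; case: cov.
Qed.

Lemma outputs_default n k c (s : seq ('I_n * 'I_n)) : n < k ->
  outputs V c k s default.
Proof. by move=> nk; exists 0; rewrite /memory_at /= /initial leqNgt nk. Qed.

Lemma space_machine n k c (G : sgraph n) s : 1 < n -> edge_stream G s ->
  space_at_most V c k s (81 * trunc_log 2 n).
Proof.
move=> n1 sG t; have t0 : 0 < trunc_log 2 n by rewrite trunc_log_gt0.
have [kn|nk] := leqP k n; last first.
  rewrite /memory_at /= /initial (leqNgt k) nk /=.
  by rewrite iter_fix //=; lia.
rewrite /memory_at.
suff: reachable n k c (n * n) (iter t (next_config V c)
    (start V n k, [seq (val p.1, val p.2) | p <- s])).
  case=> [[b ->] /=|[u [v [h [g [p [-> /and5P[un vn h1 pc gs] _]]]]]]].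
    lia.
  apply: size_write_scan => //; lia.
elim: t => [|t IHt]; last by apply: reachable_next.
right; exists n, n, 1, 0, 0; split => //=; first by rewrite /initial kn.
  by rewrite leqnn size_map (size_edge_stream sG).
by apply/allP => _ /mapP[e _ ->] /=; rewrite !ltn_ord.
Qed.

Definition witness n (G : sgraph n) k (S : {set 'I_n}) : bool :=
  (#|S| == k) && (#|edges_in G (region S)| == target k).

Definition honest : prover := fun n G k =>
  if [pick S | witness G k S] is Some W then encode k W else [::].

(** Completeness: the encoding of a witness decodes to it. Soundness: an accepted certificate
    decodes to a witness. For [n < k] the answer is constant. *)
Lemma admits_machine (P : decision_problem) :
  (forall n (G : sgraph n) k, k <= n ->
     P n G k <-> exists S, witness G k S) ->
  (forall n (G : sgraph n) k, n < k -> P n G k <-> default) ->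
  admits_scheme P (fun n k => minn (k * trunc_log 2 n) n) (trunc_log 2).
Proof.
move=> Pwit Pdef; exists honest, V; split.
  move=> n G k _; have [kn|nk] := leqP k n; last first.
    split=> [c s _|Pn s _|nP c s _].
        by exists default; apply: outputs_default.
      by have /Pdef <- := Pn => //; apply: outputs_default.
    have <- : default = false by apply/negP => /(Pdef _ G _ nk).
    exact: outputs_default.
  split=> [c s sG|/Pwit Pn s sG|nP c s sG].
      by eexists; apply: outputs_machine sG.
    have := outputs_machine (honest G k) kn sG; rewrite /honest.
    case: pickP => [S wS|noS]; last by have [S] := Pn kn; rewrite noS.
    by have /andP[/eqP Sk _] := wS; rewrite /= encodeK // -/(witness G k S) wS.
  have /= := outputs_machine c kn sG; set b := (_ && _).
  suff -> : b = false by [].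
  apply/negP => wS; apply: nP; apply/(Pwit _ _ _ kn).
  by exists (vertices n (decoded n k c)).
exists 81 => n G k n1 k0; split; last by move=> c s; apply: space_machine.
rewrite /honest; case: pickP => // S _.
by rewrite (leq_trans (size_encode S k n1)) // leq_mul2r orbT.
Qed.

End Scheme.

(** * The three problems *)

Section Problems.

Variable n : nat.
Implicit Types (G : sgraph n) (P : pred {set 'I_n}) (S : {set 'I_n}).

Lemma exists_maximum P S : P S -> exists2 M, maximum P M & #|S| <= #|M|.
Proof.
move=> PS; case: (arg_maxnP (fun M : {set 'I_n} => #|M|) PS) => M PM leM.
by exists M; [split=> // S' /leM | apply: leM].
Qed.

Lemma exists_minimum P S : P S -> exists2 M, minimum P M & #|M| <= #|S|.
Proof.
move=> PS; case: (arg_minnP (fun M : {set 'I_n} => #|M|) PS) => M PM leM.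
by exists M; [split=> // S' /leM | apply: leM].
Qed.

Lemma subset_card S k : k <= #|S| ->
  exists2 S' : {set 'I_n}, S' \subset S & #|S'| = k.
Proof.
move=> kS; have : 0 < 'C(#|S|, k) by rewrite bin_gt0.
rewrite -cards_draws card_gt0 => /set0Pn[S']; rewrite inE => /andP[sub /eqP].
by exists S'.
Qed.

(** Complement of a choice of [n - k] vertices outside [S]. *)
Lemma superset_card S k : #|S| <= k <= n ->
  exists2 S' : {set 'I_n}, S \subset S' & #|S'| = k.
Proof.
move=> /andP[Sk kn]; have := cardsC S; rewrite card_ord => cS.
have [|T sT cT] := @subset_card (~: S) (n - k); first lia.
exists (~: T); first by rewrite -setCS setCK.
by have := cardsC T; rewrite card_ord; lia.
Qed.

Lemma clique_subset G S S' : S' \subset S -> clique G S -> clique G S'.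
Proof.
move=> /subsetP sub /forall_inP cl.
apply/forall_inP => u /sub /cl /forall_inP cu.
by apply/forall_inP => v /sub /cu.
Qed.

Lemma independent_subset G S S' :
  S' \subset S -> independent G S -> independent G S'.
Proof.
move=> /subsetP sub /forall_inP ind.
apply/forall_inP => u /sub /ind /forall_inP iu.
by apply/forall_inP => v /sub /iu.
Qed.

Lemma mem_edge_set G u v : edge G u v -> [set u; v] \in edge_set G.
Proof. by move=> uv; apply/imsetP; exists (u, v). Qed.

Lemma independentE G S : independent G S = (edges_in G S == set0).
Proof.
apply/forall_inP/eqP => [ind|E0 u uS].
  apply/setP => e; rewrite !inE; apply/negP => /andP[/imsetP[[u v] uv ->]].
  rewrite subUset !sub1set /= => /andP[/ind /forall_inP uP /uP].
  by rewrite -topredE /= in uv *; rewrite uv.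
apply/forall_inP => v vS; apply/negP => /mem_edge_set uv.
by have := in_set0 [set u; v]; rewrite -E0 inE uv subUset !sub1set uS vS.
Qed.

Lemma vertex_coverE G S : vertex_cover G S = independent G (~: S).
Proof.
apply/forallP/forall_inP => [cov u|ind u].
  rewrite inE => uS; apply/forall_inP => v; rewrite inE => vS; apply/negP => uv.
  by have /forallP/(_ v) := cov u; rewrite uv (negPf uS) (negPf vS).
apply/forallP => v; apply/implyP => uv; apply: contraLR uv.
rewrite negb_or -!in_setC => /andP[/ind/forall_inP + vS]; exact.
Qed.

(** The edges inside [S] are among its ['C(#|S|, 2)] pairs, so equal cardinalities force every pair
    to be an edge. *)
Lemma cliqueE G S : clique G S = (#|edges_in G S| == 'C(#|S|, 2)).
Proof.
have sub : edges_in G S \subset [set e : {set 'I_n} | e \subset S & #|e| == 2].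
  apply/subsetP => e; rewrite !inE => /andP[/imsetP[[u v] uv ->] ->] /=.
  rewrite inE /= in uv; rewrite cards2.
  by have -> : u != v by apply: contraTneq uv => ->; rewrite edge_irr.
rewrite -cards_draws (subset_leqif_cards sub).
apply/forall_inP/eqP => [cl|eqE u uS].
  apply/eqP; rewrite eqEsubset sub; apply/subsetP => e; rewrite !inE.
  case/andP => eS /cards2P[u [v [uv eE]]]; rewrite eS andbT.
  move: eS; rewrite eE subUset !sub1set => /andP[/cl/forall_inP clu /clu].
  by rewrite uv; apply: mem_edge_set.
apply/forall_inP => v vS; apply/implyP => uv.
have : [set u; v] \in edges_in G S.
  by rewrite eqE inE cards2 uv subUset !sub1set uS vS.
rewrite inE => /andP[/imsetP[[a b] /= ab] eE _]; move: ab; rewrite inE /= => ab.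
have neq : a != b by apply: contraTneq ab => ->; rewrite edge_irr.
(* The edge [ab] behind the pair may be oriented either way; symmetry of [edge] covers both. *)
have := set21 u v; have := set22 u v; rewrite eE !inE.
by case/orP=> /eqP vE /orP[]/eqP uE; move: uv; rewrite uE vE ?eqxx // edge_sym.
Qed.

End Problems.

Theorem theorem15 :
  let cert_bits := fun n k : nat => minn (k * trunc_log 2 n) n in
  let space := fun n : nat => trunc_log 2 n in
  [/\ admits_scheme MaxIS_ge cert_bits space,
      admits_scheme MaxClique_ge cert_bits space
    & admits_scheme MinVC_le cert_bits space].
Proof.
move=> cert_bits space.
have le_n n (S : {set 'I_n}) : #|S| <= n.
  by rewrite -[X in _ <= X]card_ord max_card.
split.
- apply: (@admits_machine false (fun=> 0) false) => n G k nk; last first.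
    by split=> // -[S [_ kS]]; have := le_n _ S; rewrite leqNgt (leq_trans nk kS).
  (* A maximum set is cut down to exactly [k] vertices; conversely, a maximum set is at least as
     large as any witness. *)
  split=> [[S [[ind _] /subset_card[S' sub S'k]]]|[S]].
    exists S'; rewrite /witness S'k eqxx cards_eq0 -independentE.
    exact: independent_subset ind.
  rewrite /witness cards_eq0 -independentE => /andP[/eqP <- ind].
  by have [M] := exists_maximum ind; exists M.
- apply: (@admits_machine false (fun k => 'C(k, 2)) false) => n G k nk; last first.
    by split=> // -[S [_ kS]]; have := le_n _ S; rewrite leqNgt (leq_trans nk kS).
  split=> [[S [[cl _] /subset_card[S' sub S'k]]]|[S]].
    exists S'; rewrite /witness -S'k eqxx -cliqueE.
    exact: clique_subset cl.
  rewrite /witness => /andP[/eqP <-]; rewrite -cliqueE => cl.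
  by have [M] := exists_maximum cl; exists M.
(* For [n < k] the answer is yes, as no cover exceeds [n] vertices. *)
- apply: (@admits_machine true (fun=> 0) true) => n G k nk; last first.
    split=> // _; have covT : vertex_cover G setT.
      by apply/forallP => u; apply/forallP => v; rewrite inE implybT.
    have [M minM _] := exists_minimum covT; exists M; split=> //.
    by rewrite (leq_trans (le_n _ M)) // ltnW.
  split=> [[S [[cov _] Sk]]|[S]].
    (* Covers are closed under supersets, so a small one can be padded to size [k]. *)
    have [|S' sub S'k] := @superset_card n S k; first by rewrite Sk.
    exists S'; rewrite /witness S'k eqxx cards_eq0 -independentE.
    by move: cov; rewrite vertex_coverE; apply: independent_subset; rewrite setCS.
  rewrite /witness cards_eq0 -independentE -vertex_coverE => /andP[/eqP <- cov].
  by have [M] := exists_minimum cov; exists M.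
Qed.
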